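(* The generalized Heller constant satisfies $h(\Delta,m) = O(m^3 \Delta)$; that is, there exists an absolute constant $C > 0$ such that $h(\Delta, m) \le C\, m^3 \Delta$ for all integers $\Delta \ge 1$ and $m \ge 1$.
   Context: For a matrix $A \in \mathbb{R}^{m \times n}$ of rank $m$, let $\Delta_m(A)$ denote the maximum of the absolute values of the determinants of all $m \times m$ submatrices of $A$. The matrix $A$ is called $\Delta$-modular if $\Delta_m(A) = \Delta$. The generalized Heller constant $h(\Delta, m)$ is the maximum integer $n > 0$ such that there exists an integer matrix $A \in \mathbb{Z}^{m \times n}$ of rank $m$ with pairwise distinct columns that is $\Delta$-modular. *)

(* Defs.v *)
From HB Require Import structures.
From mathcomp Require Import all_boot all_order all_algebra.
From mathcomp Require Import boolp classical_sets reals.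

Set Implicit Arguments.
Unset Strict Implicit.
Unset Printing Implicit Defensive.

Import Order.TTheory GRing.Theory Num.Theory.

Local Open Scope ring_scope.
Local Open Scope classical_set_scope.

Definition increasing_ffun (m n : nat) (f : {ffun 'I_m -> 'I_n}) : bool :=
  [forall i : 'I_m, forall j : 'I_m, (i < j)%N ==> (f i < f j)%N].

(* An m x m submatrix of an m x n matrix is the choice of m columns, in their
   original order. The index 0 of the iterated maximum is harmless: the values
   are nonnegative, and a matrix of rank m has at least one such submatrix. *)
Definition max_minor (R : realDomainType) (m n : nat) (A : 'M[R]_(m, n)) : R :=
  \big[Num.max/0]_(f : {ffun 'I_m -> 'I_n} | increasing_ffun f)
    `|\det (colsub f A)|.

Definition modular (R : realDomainType) (m n : nat) (Delta : R)
    (A : 'M[R]_(m, n)) : Prop :=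
  max_minor A = Delta.

(* The rank of an integer matrix is taken over its field of fractions. *)
Definition int_rank (m n : nat) (A : 'M[int]_(m, n)) : nat :=
  \rank (map_mx (intr : int -> rat) A).

Definition heller_admissible (Delta m n : nat) : Prop :=
  (0 < n)%N /\
  exists A : 'M[int]_(m, n),
    [/\ int_rank A = m,
        injective (fun j : 'I_n => col j A)
      & modular Delta%:Z A].

Definition is_generalized_heller (Delta m h : nat) : Prop :=
  heller_admissible Delta m h /\
  (forall n : nat, heller_admissible Delta m n -> (n <= h)%N).

(* The maximum chosen classically; 0 is the default value if no maximum exists,
   so this is meaningful only together with
   [is_generalized_heller Delta m (generalized_heller Delta m)]. *)
Definition generalized_heller (Delta m : nat) : nat :=
  xget 0%N [set h : nat | is_generalized_heller Delta m h].

(* Main.v *)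
Require Import Defs.
From HB Require Import structures.
From mathcomp Require Import all_boot all_order all_algebra.
From mathcomp Require Import boolp classical_sets reals.
From mathcomp Require Import zify ring lra.
From mathcomp Require Import fintype finset perm.

Set Implicit Arguments.
Unset Strict Implicit.
Unset Printing Implicit Defensive.

Import Order.TTheory GRing.Theory Num.Theory.

Local Open Scope ring_scope.

(** Let [A] be Delta-modular, [B] a maximal submatrix with [|det B| = Delta], and
    [Q = B^-1 A].  The maximal minors of [Q] are at most 1 in absolute value, and
    [Q] contains the identity, so all its minors of every order are at most 1
    ([minor_le1]).  The columns of [A] fall into at most [Delta] residue classes
    modulo the lattice spanned by [B] ([residue_classes]), and columns of [A] in
    one class give columns of [Q] that differ by integer vectors.  It remains to
    show that a class has O(m^3) elements ([card_class]).

    Within a class, coordinate [i] of a column of [Q] lies in [t i + Z] and between -1 and 1, so the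
    column is determined by the set of thresholds [t i] and [t i + 1] that its
    coordinates reach, a subset of a set of size 2m.  A family of subsets has at
    most as many members as there are sets that it shatters
    ([leq_card_shattered]), so a class that shatters no 4-set has O(m^3) elements.

    Shattering k thresholds means that the class realises all sign patterns
    relative to a k-dimensional box with sides of length 1.  Determinants are
    affine in each column, so all matrices whose columns are vertices of that box
    have determinant at most 1 in absolute value ([det_box_le1]).  Suppose that
    one of k + 1 rows is held at the value [eta] while the vertices of a unit box
    vary freely in the others.  A suitable choice of vertices gives a determinant
    of absolute value [(k - 1) |eta|] ([det_const_row]).  This is used twice.

    - Four shattered rows: hold the first one at the lower or at the upper end of
      its unit interval; then [2 |eta| <= 1] for both ends, so the interval is
      [-1/2, 1/2] ([shattered4_level]).
    - If some row has a threshold at 1/2, its entries are 1/2 or -1/2.  Split the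
      class by their sign.  If one of the two parts shattered four thresholds, that
      constant row together with the four rows would give
      [3 * 1/2 <= 1] ([const_row_no_shattered4]).

    Hence either the class itself or each of its two parts shatters no 4-set.
    Without the splitting, 4-sets could be shattered, as all vectors with
    coordinates 1/2 and -1/2 show for [m = 4], and the bound would be O(m^4). *)

(** * Shattered sets *)

Definition shatters (X : finType) (F : {set {set X}}) (T : {set X}) : bool :=
  [forall U : {set X}, (U \subset T) ==> [exists A in F, A :&: T == U]].

Lemma shattersP (X : finType) (F : {set {set X}}) (T : {set X}) :
  reflect (forall U : {set X}, U \subset T -> exists2 A, A \in F & A :&: T = U)
          (shatters F T).
Proof.
apply: (iffP forallP) => [sh U UT|sh U].
  have /implyP/(_ UT)/existsP[A /andP[AF /eqP AU]] := sh U.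
  by exists A.
apply/implyP => UT; have [A AF AU] := sh U UT.
by apply/existsP; exists A; rewrite AF AU eqxx.
Qed.

Lemma shatters_subset (X : finType) (F : {set {set X}}) (S T : {set X}) :
  S \subset T -> shatters F T -> shatters F S.
Proof.
move=> ST /shattersP sh; apply/shattersP => U US.
have [A AF AU] := sh U (subset_trans US ST).
exists A => //; rewrite -[S in LHS](setIidPr ST) setIA AU.
exact/setIidPl.
Qed.

Lemma shatters_subfamily (X : finType) (F G : {set {set X}}) (T : {set X}) :
  F \subset G -> shatters F T -> shatters G T.
Proof.
move=> FG /shattersP sh; apply/shattersP => U UT.
by have [A AF AU] := sh U UT; exists A => //; apply: (subsetP FG).
Qed.

(** Pajor's form of the Sauer-Shelah lemma.  Split the family by a point that
    some members contain and others avoid; a set shattered by both halves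
    avoids that point, and is shattered by the whole family also after the point
    is added to it.  So every set counted for both halves has a second set to
    account for it. *)
Lemma leq_card_shattered (X : finType) (F : {set {set X}}) :
  (#|F| <= #|[set T | shatters F T]|)%N.
Proof.
have [n] := ubnP #|F|; elim: n F => // n IH F /ltnSE leFn.
have [F1|] := leqP #|F| 1%N.
  have [->|[A AF]] := set_0Vmem F; first by rewrite cards0.
  apply: leq_trans F1 _; rewrite card_gt0; apply/set0Pn; exists set0.
  rewrite inE; apply/shattersP => U; rewrite subset0 => /eqP ->.
  by exists A => //; rewrite setI0.
move=> /card_gt1P[A [B [AF BF]]] AB.
have [x xAB] : exists x, (x \in A) != (x \in B).
  apply/existsP; apply: contraNT AB; rewrite negb_exists => /forallP H.
  by apply/eqP/setP => x; apply/eqP; have := H x; rewrite negbK.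
pose F1 := [set C in F | x \in C]; pose F0 := [set C in F | x \notin C].
have cardF : #|F| = (#|F1| + #|F0|)%N.
  rewrite -(cardsID [set C : {set X} | x \in C] F); congr (_ + _)%N; apply: eq_card => C.
    by rewrite !inE.
  by rewrite !inE andbC.
have [F1_gt0 F0_gt0] : (0 < #|F1| /\ 0 < #|F0|)%N.
  rewrite !card_gt0; case: (boolP (x \in A)) xAB => xA; case: (boolP (x \in B)) => xB // _.
    by split; apply/set0Pn; [exists A|exists B]; rewrite inE ?AF ?BF.
  by split; apply/set0Pn; [exists B|exists A]; rewrite inE ?AF ?BF.
pose S (G : {set {set X}}) := [set T | shatters G T].
have shF1 T : shatters F1 T -> x \notin T.
  move=> /shattersP/(_ set0 (sub0set _))[C]; rewrite inE => /andP[_ xC] CT.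
  by apply/negP => xT; have := in_set0 x; rewrite -CT inE xC xT.
have shF0 T : shatters F0 T -> x \notin T.
  move=> /shattersP/(_ T (subxx _))[C]; rewrite inE => /andP[_ xC] CT.
  by apply/negP => xT; move: xC; rewrite -CT in xT; move: xT; rewrite inE => /andP[->].
have inj_x : {in S F1 :&: S F0 &, injective (fun T : {set X} => x |: T)}.
  move=> T T'; rewrite !inE => /andP[/shF1 xT _] /andP[/shF1 xT' _] eqT.
  by rewrite -(setU1K xT) -(setU1K xT') eqT.
apply: (@leq_trans (#|S F1 :|: S F0| + #|(fun T : {set X} => x |: T) @: (S F1 :&: S F0)|)).
  rewrite card_in_imset // cardsUI cardF leq_add // IH //; lia.
rewrite -cardsUI [X in (_ + X)%N](_ : _ = 0%N) ?addn0.
  apply/subset_leq_card/subsetP => T; rewrite !inE => /orP[/orP[]|].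
  - by apply: shatters_subfamily; apply/subsetP => C; rewrite inE => /andP[].
  - by apply: shatters_subfamily; apply/subsetP => C; rewrite inE => /andP[].
  move=> /imsetP[T']; rewrite !inE => /andP[sh1 sh0] ->{T}.
  apply/shattersP => U UT.
  have xT' := shF1 _ sh1.
  have UxT' : U :\ x \subset T'.
    by apply/subsetP => y; rewrite !inE => /andP[yx /(subsetP UT)]; rewrite !inE (negPf yx).
  case: (boolP (x \in U)) => xU.
    have /shattersP/(_ _ UxT')[C] := sh1; rewrite inE => /andP[CF xC] CT.
    exists C => //; rewrite setIUr CT -(setD1K xU); congr (_ :|: _).
      by apply/setIidPr; rewrite sub1set.
    by rewrite setD1K.
  have /shattersP/(_ _ UxT')[C] := sh0; rewrite inE => /andP[CF xC] CT.
  exists C => //; rewrite setIUr CT.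
  rewrite (_ : C :&: [set x] = set0) ?set0U.
    by apply/setP => y; rewrite !inE; case: eqP => // ->; rewrite (negPf xU).
  by apply/setP => y; rewrite !inE; case: eqP => [->|_]; rewrite ?(negPf xC) ?andbF.
apply/eqP; rewrite cards_eq0; apply/eqP/setP => T; rewrite !inE.
apply/negP => /andP[sh /imsetP[T' _ eT]].
have xT : x \in T by rewrite eT !inE eqxx.
by case/orP: sh => [/shF1|/shF0]; rewrite xT.
Qed.

Lemma leq_bin_exp (n k : nat) : ('C(n, k) <= n ^ k)%N.
Proof.
have mono n' k' : (n' ^ k' <= n'.+1 ^ k')%N by case: k' => // k'; rewrite leq_exp2r.
elim: n k => [|n IH] [|k] //; rewrite binS addnC expnS mulSn leq_add //.
  exact: leq_trans (IH _) (mono _ _).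
by apply: leq_trans (IH _) _; rewrite expnS leq_mul2l mono orbT.
Qed.

Lemma card_no_shattered (X : finType) (F : {set {set X}}) (d : nat) :
  (0 < #|X|)%N -> (forall T : {set X}, #|T| = d.+1 -> ~~ shatters F T) ->
  (#|F| <= d.+1 * #|X| ^ d)%N.
Proof.
move=> X0 nsh; apply: leq_trans (leq_card_shattered F) _.
have sub : [set T | shatters F T] \subset \bigcup_(k < d.+1) [set T : {set X} | #|T| == k].
  apply/subsetP => T; rewrite inE => shT.
  have dT : (#|T| < d.+1)%N.
    rewrite ltnNge; apply/negP => leT.
    have [S ST cS] : exists2 S : {set X}, S \subset T & #|S| = d.+1.
      have : (0 < #|[set A : {set X} | A \subset T & #|A| == d.+1]|)%N.
        by rewrite cards_draws bin_gt0.
      by rewrite card_gt0 => /set0Pn[S]; rewrite inE => /andP[ST /eqP]; exists S.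
    by have := nsh S cS; rewrite (shatters_subset ST).
  by apply/bigcupP; exists (Ordinal dT) => //; rewrite inE.
apply: leq_trans (subset_leq_card sub) _.
apply: (@leq_trans (\sum_(k < d.+1) #|[set T : {set X} | #|T| == k]|)).
  apply: (big_ind2 (fun (A : {set {set X}}) s => #|A| <= s)%N) => //; first by rewrite cards0.
  by move=> A1 s1 A2 s2 h1 h2; apply: leq_trans (leq_card_setU _ _) (leq_add h1 h2).
rewrite -[X in (_ <= X * _)%N]card_ord -sum_nat_const leq_sum // => k _.
rewrite card_draws; apply: leq_trans (leq_bin_exp _ _) _.
by rewrite leq_pexp2l // -ltnS.
Qed.

(** * Determinants *)

Lemma det_1Dmulmx (R : comNzRingType) (m k : nat) (U : 'M[R]_(m, k)) (V : 'M[R]_(k, m)) :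
  \det (1%:M + U *m V) = \det (1%:M + V *m U).
Proof.
pose M : 'M_(m + k) := block_mx 1%:M (- U) V 1%:M.
transitivity (\det M).
  have -> : M = block_mx (1%:M + U *m V) (- U) 0 1%:M *m block_mx 1%:M 0 V 1%:M.
    by rewrite mulmx_block !mulmx1 mul0mx mul1mx mulmx0 !add0r mulNmx addrK.
  by rewrite det_mulmx det_ublock det_lblock !det1 !mulr1.
have -> : M = block_mx 1%:M 0 V 1%:M *m block_mx 1%:M (- U) 0 (1%:M + V *m U).
  by rewrite mulmx_block !mul1mx !mul0mx !mulmx1 !addr0 mulmxN addrC addrK.
by rewrite det_mulmx det_ublock det_lblock !det1 !mul1r.
Qed.

Lemma det_all1_sub1 (R : comNzRingType) (k : nat) :
  \det (const_mx 1 - 1%:M : 'M[R]_k) = (-1) ^+ k * (1 - k%:R).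
Proof.
pose U : 'cV[R]_k := const_mx (-1); pose V : 'rV[R]_k := const_mx 1.
have -> : const_mx 1 - 1%:M = -1 *: (1%:M + U *m V) :> 'M[R]_k.
  apply/matrixP => i j; rewrite !mxE big_ord1 !mxE; ring.
rewrite detZ det_1Dmulmx det_mx11 !mxE.
congr (_ * (_ + _)); rewrite (eq_bigr (fun=> -1)) ?sumr_const ?card_ord ?mulNrn //.
by move=> i _; rewrite !mxE mulrN1.
Qed.

(** Replacing columns of the identity by columns of [Q] and expanding along the
    untouched ones leaves a minor of [Q]; here this comes out of the identity
    [det (1 + U V) = det (1 + V U)], with no reordering of rows. *)
Lemma minor_le1 (R : realDomainType) (m n k : nat) (Q : 'M[R]_(m, n)) (f : 'I_m -> 'I_n)
    (r : 'I_k -> 'I_m) (g : 'I_k -> 'I_n) :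
  colsub f Q = 1%:M -> (forall g', `|\det (colsub g' Q)| <= 1) -> injective r ->
  `|\det (mxsub r g Q)| <= 1.
Proof.
move=> fQ Q1 r_inj.
pose g' i := if [pick j | r j == i] is Some j then g j else f i.
have <- : \det (colsub g' Q) = \det (mxsub r g Q); last exact: Q1.
pose P : 'M[R]_(m, k) := colsub r 1%:M.
have -> : colsub g' Q = 1%:M + (colsub g Q - P) *m P^T.
  apply/matrixP => i i'; rewrite !mxE /g'.
  case: pickP => [j /eqP rj|rN].
    rewrite (bigD1 j) //= big1 => [|j' jj']; rewrite !mxE.
      by rewrite rj eqxx mulr1 addr0 addrC subrK.
    by rewrite -rj [r j == _]eq_sym (inj_eq r_inj) (negPf jj') mulr0.
  rewrite big1 => [|j _]; rewrite ?addr0.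
    by have := congr1 (fun M : 'M_m => M i i') fQ; rewrite !mxE.
  by rewrite !mxE [i' == _]eq_sym rN mulr0.
rewrite det_1Dmulmx mulmxBr.
have PE p (M : 'M[R]_(m, p)) : P^T *m M = rowsub r M.
  by rewrite [RHS]rowsubE; congr (_ *m _); apply/matrixP => i j; rewrite !mxE eq_sym.
congr (\det _); rewrite !PE; apply/matrixP => i j; rewrite !mxE.
by rewrite (inj_eq r_inj); ring.
Qed.

(** A box is contained in the convex hull of any points that realise all sign
    patterns relative to its facets, and a determinant, being affine in each
    column, is largest at extreme points.  So the bound passes from the given
    points to the vertices of the box, some of whose sides may be trivial. *)
Lemma det_box_le1 (R : realDomainType) (k n : nat) (V : 'M[R]_(k, n)) (lo hi : 'I_k -> R) :
  (forall i, lo i <= hi i) -> (forall g, `|\det (colsub g V)| <= 1) ->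
  (forall s : 'I_k -> bool, exists j, forall i, if s i then hi i <= V i j else V i j <= lo i) ->
  forall e : 'I_k -> 'I_k -> bool,
    `|\det (\matrix_(i, j) (if e i j then hi i else lo i))| <= 1.
Proof.
move=> lohi V1 patV e; set W := \matrix_(i, j) _.
pose mix l (g : 'I_k -> 'I_n) : 'M[R]_k := \matrix_(i, j) if (j < l)%N then W i j else V i (g j).
(* Expanding along column [l], the sign of each cofactor tells on which side of
   the box the replacing point has to lie; [z] is the sign of the determinant. *)
have mix1 (z : R) : `|z| = 1 -> forall l, (l <= k)%N -> forall g, z * \det (mix l g) <= 1.
  move=> z1; elim=> [_ g|l IH lk g].
    apply: le_trans (ler_norm _) _; rewrite normrM z1 mul1r.
    have -> : mix 0%N g = colsub g V by apply/matrixP => i j; rewrite !mxE.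
    exact: V1.
  pose c := Ordinal lk; pose u i := z * cofactor (mix l.+1 g) i c.
  have [j patj] := patV (fun i => 0 <= u i).
  pose g' i := if i == c then j else g i.
  apply: le_trans (IH (ltnW lk) g').
  rewrite !(expand_det_col _ c) !mulr_sumr ler_sum // => i _.
  have -> : cofactor (mix l g') i c = cofactor (mix l.+1 g) i c.
    rewrite /cofactor; congr (_ * \det _); apply/matrixP => a b; rewrite !mxE.
    have bc : lift c b != c by rewrite eq_sym neq_lift.
    have -> : (lift c b < l.+1)%N = (lift c b < l)%N.
      by rewrite ltnS leq_eqVlt; move: bc; rewrite -val_eqE /= => /negPf ->.
    by rewrite /g' (negPf bc).
  rewrite [leLHS]mulrCA [leRHS]mulrCA -/(u i) !mxE /= ltnSn ltnn /g' eqxx.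
  case: (lerP 0 (u i)) (patj i) => [u0|u0] patji.
    apply: (ler_wpM2r u0). apply: le_trans patji. by case: ifP.
  apply: (ler_wnM2r (ltW u0)). by apply: (le_trans patji); case: ifP.
have mixk (g : 'I_k -> 'I_n) : mix k g = W by apply/matrixP => i j; rewrite mxE ltn_ord.
have [j0 _] := patV xpredT.
have := mix1 1 (normr1 _) k (leqnn k) (fun=> j0).
have := mix1 (-1) (normrN1 _) k (leqnn k) (fun=> j0).
by rewrite mixk mul1r mulN1r ler_norml lerNl => -> ->.
Qed.

(** Subtracting the first column from the others turns the constant row into
    [(eta, 0, ..., 0)] and leaves the matrix [J - I], with [J] the all-ones
    matrix, below it.  Among the 0/1 matrices of order 3 and 4, [J - I] has a
    determinant of largest absolute value, namely 2 and 3. *)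
Lemma det_const_row (R : comNzRingType) (k : nat) (eta : R) (lo : 'I_k -> R) :
  \det (block_mx eta%:M (const_mx eta) (\col_i lo i)
          (\matrix_(i, j) (lo i + (i != j)%:R)) : 'M_(1 + k)) =
  eta * ((-1) ^+ k * (1 - k%:R)).
Proof.
set M := block_mx _ _ _ _.
have -> : M = block_mx eta%:M 0 (\col_i lo i) (const_mx 1 - 1%:M) *m
              block_mx 1%:M (const_mx 1) 0 1%:M.
  rewrite mulmx_block !mulmx1 !mulmx0 !addr0 /M; congr block_mx.
    by apply/matrixP => i j; rewrite mul_scalar_mx !mxE mulr1.
  apply/matrixP => i j; rewrite !mxE big_ord1 !mxE mulr1.
  by case: eqP => _ /=; ring.
by rewrite det_mulmx det_lblock det_ublock !det1 !mulr1 det_scalar1 det_all1_sub1.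
Qed.

(** The vertices are chosen so that the matrix is the one of [det_const_row]: all
    of them on the same side in the first row, and in the other rows the first
    one at the lower corner and the others one coordinate short of the upper
    corner. *)
Lemma pattern_row_bound (R : realDomainType) (k n : nat) (V : 'M[R]_(1 + k, n))
    (lo hi : 'I_(1 + k) -> R) (b : bool) :
  (forall i, lo i <= hi i) -> (forall i, hi (rshift 1 i) = lo (rshift 1 i) + 1) ->
  (forall g, `|\det (colsub g V)| <= 1) ->
  (forall s : 'I_(1 + k) -> bool,
     exists j, forall i, if s i then hi i <= V i j else V i j <= lo i) ->
  `|(if b then hi else lo) (lshift k ord0)| * `|1 - k%:R : R| <= 1.
Proof.
move=> lohi hilo V1 pat.
pose e (i j : 'I_(1 + k)) := match split i, split j with
  | inl _, _ => b | inr _, inl _ => false | inr i', inr j' => i' != j' end.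
have := det_box_le1 lohi V1 pat e.
set eta := (if b then hi else lo) _; set W := \matrix_(i, j) _.
have -> : W = block_mx eta%:M (const_mx eta) (\col_i lo (rshift 1 i))
          (\matrix_(i, j) (lo (rshift 1 i) + (i != j)%:R)).
  rewrite -[LHS]submxK; congr block_mx; apply/matrixP => i j; rewrite !mxE /e /=.
  - by rewrite !ord1 (unsplitK (inl _)) eqxx /eta; case: (b).
  - by rewrite !ord1 (unsplitK (inl _)) /eta; case: (b).
  - by rewrite (unsplitK (inl _)) (unsplitK (inr _)).
  - by rewrite !(unsplitK (inr _)) hilo; case: eqP; rewrite ?addr0.
by rewrite det_const_row !normrM normrX normrN1 expr1n mul1r.
Qed.

(** * Columns in one residue class *)

Lemma shattered_pattern (X I : finType) (f : I -> {set X}) (G : {set I}) (T : {set X})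
    (k : nat) :
  shatters (f @: G) T -> #|T| = k ->
  exists2 s : 'I_k -> X, injective s &
    forall b : 'I_k -> bool, exists2 j, j \in G & forall i, (s i \in f j) = b i.
Proof.
move=> /shattersP sh cT; case: k / cT.
exists enum_val; first exact: enum_val_inj.
move=> b; have [|A /imsetP[j jG ->] AT] := sh [set enum_val i | i in [pred i | b i]].
  by apply/subsetP => x /imsetP[i _ ->]; apply: enum_valP.
exists j => // i; transitivity (enum_val i \in f j :&: T).
  by rewrite inE enum_valP andbT.
by rewrite AT mem_imset ?inE //; apply: enum_val_inj.
Qed.

Definition minors_le1 (R : realDomainType) (m n : nat) (Q : 'M[R]_(m, n)) : Prop :=
  forall (k : nat) (r : 'I_k -> 'I_m) (g : 'I_k -> 'I_n),
    injective r -> `|\det (mxsub r g Q)| <= 1.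

Definition congruent_to (R : archiRealFieldType) (m n : nat) (Q : 'M[R]_(m, n))
    (t : 'I_m -> R) (G : {set 'I_n}) : Prop :=
  forall j, j \in G -> forall i, Q i j - t i \is a Num.int.

(** A number between -1 and 1 with fractional part [t] is [t - 1], [t] or
    [t + 1], the last one only when [t = 0]; so two thresholds per row, [t] and
    [t + 1], tell all values apart. *)
Definition level (R : archiRealFieldType) (m : nat) (t : 'I_m -> R) (s : 'I_m * bool) : R :=
  t s.1 + s.2%:R.

Definition upset (R : archiRealFieldType) (m n : nat) (Q : 'M[R]_(m, n))
    (t : 'I_m -> R) (j : 'I_n) : {set 'I_m * bool} :=
  [set s | level t s <= Q s.1 j].

Lemma upset_gap (R : archiRealFieldType) (m n : nat) (Q : 'M[R]_(m, n))
    (t : 'I_m -> R) (G : {set 'I_n}) (j : 'I_n) (s : 'I_m * bool) :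
  congruent_to Q t G -> j \in G ->
  if s \in upset Q t j then level t s <= Q s.1 j else Q s.1 j <= level t s - 1.
Proof.
move=> QtG jG; have /intrP[z Qz] := QtG j jG s.1.
case: ifP; rewrite inE // => /negbT; rewrite -ltNge.
have -> : Q s.1 j = t s.1 + z%:~R by rewrite -Qz; ring.
rewrite /level ltrD2l -addrA lerD2l; case: s.2 => /=.
  by rewrite subrr (ltr_int _ z 1) (ler_int _ z 0) -ltzD1.
by rewrite add0r (ltr_int _ z 0) (ler_int _ z (-1)) -(ltzD1 z (-1)).
Qed.

(** Reaching the higher threshold of a row implies reaching the lower one, so a
    shattered set contains at most one threshold per row. *)
Lemma pattern_rows_inj (R : archiRealFieldType) (m n k : nat) (Q : 'M[R]_(m, n))
    (t : 'I_m -> R) (G : {set 'I_n}) (s : 'I_k -> 'I_m * bool) :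
  injective s ->
  (forall b : 'I_k -> bool, exists2 j, j \in G & forall i, (s i \in upset Q t j) = b i) ->
  injective (fun i => (s i).1).
Proof.
move=> s_inj pat.
have no2 a i i' : s i = (a, true) -> s i' = (a, false) -> False.
  move=> si si'; have [j _ bj] := pat (fun l => s l == (a, true)).
  have := bj i; have := bj i'; rewrite si si' !inE eqxx xpair_eqE andbF /level /=.
  move=> /negbT; rewrite -ltNge addr0 => lt1 le1; have := le_lt_trans le1 lt1.
  by rewrite gtrDl ltr10.
move=> i i' /= ii'; apply: s_inj; move: ii'.
case E: (s i) => [a e]; case E': (s i') => [a' e'] /= aa'; subst a'.
by case: e e' E E' => [] [] // E E'; [case: (no2 a i i')|case: (no2 a i' i)].
Qed.

Lemma colsub_rowsub (R : Type) (m n p q : nat) (A : 'M[R]_(m, n)) (r : 'I_p -> 'I_m)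
    (g : 'I_q -> 'I_n) : colsub g (rowsub r A) = mxsub r g A.
Proof. by apply/matrixP => i j; rewrite !mxE. Qed.

(** Holding the first of the four rows at an end of its unit interval gives a
    determinant of twice that end, so both ends have absolute value at most
    1/2. *)
Lemma shattered4_level (R : archiRealFieldType) (m n : nat) (Q : 'M[R]_(m, n))
    (t : 'I_m -> R) (G : {set 'I_n}) (T : {set 'I_m * bool}) :
  minors_le1 Q -> congruent_to Q t G -> #|T| = 4%N -> shatters (upset Q t @: G) T ->
  exists s, level t s = 2^-1.
Proof.
move=> Q1 QtG cT shT; have [s s_inj pat] := shattered_pattern shT cT.
have r_inj := pattern_rows_inj s_inj pat.
pose V := rowsub (fun i => (s i).1) Q : 'M_(1 + 3, n).
pose hi (i : 'I_(1 + 3)) := level t (s i); pose lo i := hi i - 1.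
have bd b : `|(if b then hi else lo) (lshift 3 ord0)| * `|1 - 3%:R : R| <= 1.
  apply: (@pattern_row_bound _ _ _ V lo hi).
  - by move=> i; rewrite /lo gerBl.
  - by move=> i; rewrite /lo subrK.
  - by move=> g; rewrite colsub_rowsub; apply: Q1.
  move=> c; have [j jG cj] := pat c; exists j => i; rewrite -cj mxE.
  exact: upset_gap QtG jG.
exists (s (lshift 3 (ord0 : 'I_1))).
have := bd true; have := bd false; rewrite /lo /hi.
move: (level _ _) => x.
have -> : `|1 - 3%:R : R| = 2 by rewrite distrC (_ : 3%:R - 1 = 2) ?normr_nat //; ring.
rewrite -!ler_pdivlMr // !ler_norml => /andP[h1 h2] /andP[h3 h4]; lra.
Qed.

(** With a constant row of absolute value 1/2 added to four shattered rows, some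
    determinant of order 5 would be 3/2 in absolute value. *)
Lemma const_row_no_shattered4 (R : archiRealFieldType) (m n : nat) (Q : 'M[R]_(m, n))
    (t : 'I_m -> R) (G : {set 'I_n}) (T : {set 'I_m * bool}) (i0 : 'I_m) (eta : R) :
  minors_le1 Q -> congruent_to Q t G -> (forall j, j \in G -> Q i0 j = eta) ->
  `|eta| = 2^-1 -> #|T| = 4%N -> ~~ shatters (upset Q t @: G) T.
Proof.
move=> Q1 QtG Qi0 eta2 cT; apply/negP => shT.
have [s s_inj pat] := shattered_pattern shT cT.
have s_inj1 := pattern_rows_inj s_inj pat.
(* A row with a shattered threshold takes values at least 1 apart. *)
have si0 i : (s i).1 != i0.
  apply/eqP => si0.
  have [j jG /(_ i) ji] := pat xpredT; have [j' jG' /(_ i) ji'] := pat xpred0.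
  have := upset_gap (s i) QtG jG; have := upset_gap (s i) QtG jG'.
  by rewrite ji ji' si0 !Qi0 // => h1 h2; lra.
pose r (i : 'I_(1 + 4)) := match split i with inl _ => i0 | inr i => (s i).1 end.
pose hi (i : 'I_(1 + 4)) := match split i with inl _ => eta | inr i => level t (s i) end.
pose lo (i : 'I_(1 + 4)) := match split i with inl _ => eta | inr i => level t (s i) - 1 end.
have r_inj : injective r.
  move=> i i'; rewrite /r -[i]splitK -[i']splitK !unsplitK.
  case: (split i) (split i') => [a|a] [a'|a'] /=; rewrite ?ord1 //.
  - by move=> ii'; have := si0 a'; rewrite -ii' eqxx.
  - by move=> ii'; have := si0 a; rewrite ii' eqxx.
  by move=> /s_inj1 ->.
have : `|hi (lshift 4 ord0)| * `|1 - 4%:R : R| <= 1.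
  apply: (@pattern_row_bound _ _ _ (rowsub r Q) lo hi true).
  - by move=> i; rewrite /lo /hi; case: split => // a; rewrite gerBl.
  - by move=> i; rewrite /lo /hi (unsplitK (inr _)) subrK.
  - by move=> g; rewrite colsub_rowsub; apply: Q1.
  move=> c; have [j jG cj] := pat (fun i => c (rshift 1 i)); exists j => i.
  rewrite mxE /r /hi /lo; have := splitK i; case: split => a <- /=.
    by rewrite Qi0 //; case: ifP.
  by rewrite -cj; apply: upset_gap QtG jG.
rewrite /hi (unsplitK (inl _)) eta2.
have -> : `|1 - 4%:R : R| = 3 by rewrite distrC (_ : 4%:R - 1 = 3) ?normr_nat //; ring.
by rewrite -ler_pdivlMr // => h; lra.
Qed.

Lemma entry_le1 (R : realDomainType) (m n : nat) (Q : 'M[R]_(m, n)) (i : 'I_m) (j : 'I_n) :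
  minors_le1 Q -> `|Q i j| <= 1.
Proof.
move=> Q1; have := Q1 1%N (fun=> i) (fun=> j); rewrite det_mx11 mxE; apply.
by move=> a b; rewrite !ord1.
Qed.

Lemma upset_inj (R : archiRealFieldType) (m n : nat) (Q : 'M[R]_(m, n))
    (t : 'I_m -> R) (J : {set 'I_n}) :
  minors_le1 Q -> congruent_to Q t J -> (forall i, 0 <= t i < 1) ->
  injective (fun j => col j Q) -> {in J &, injective (upset Q t)}.
Proof.
move=> Q1 QtJ t01 Qinj j j' jJ jJ' ujj'; apply: Qinj; apply/colP => i; rewrite !mxE.
have /intrP[z Qz] := QtJ j jJ i; have /intrP[z' Qz'] := QtJ j' jJ' i.
have zE : Q i j = t i + z%:~R by rewrite -Qz; ring.
have zE' : Q i j' = t i + z'%:~R by rewrite -Qz'; ring.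
have rng (y : int) : `|t i + y%:~R| <= 1 -> -2 < y <= 1.
  have /andP[t0 t1] := t01 i; rewrite ler_norml => /andP[h1 h2].
  by apply/andP; split; rewrite -?(ltr_int R) -?(ler_int R); lra.
have zr := entry_le1 i j Q1; rewrite zE in zr; have := rng _ zr => {}zr.
have zr' := entry_le1 i j' Q1; rewrite zE' in zr'; have := rng _ zr' => {}zr'.
have /setP/(_ (i, false)) := ujj'; have /setP/(_ (i, true)) := ujj'.
rewrite !inE /level /= zE zE' !addr0 !lerDl !lerD2l !ler0z !(ler_int _ 1).
by move=> h1 h0; congr (_ + _%:~R); lia.
Qed.

(** If some threshold is 1/2, its row takes only the values 1/2 and -1/2, and
    each half of the class on which it is constant shatters no 4-set; otherwise
    the class itself shatters none. *)
Lemma card_class (R : archiRealFieldType) (m n : nat) (Q : 'M[R]_(m, n))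
    (t : 'I_m -> R) (J : {set 'I_n}) :
  (0 < m)%N -> minors_le1 Q -> congruent_to Q t J -> (forall i, 0 <= t i < 1) ->
  injective (fun j => col j Q) -> (#|J| <= 64 * m ^ 3)%N.
Proof.
move=> m0 Q1 QtJ t01 Qinj.
have X0 : (0 < #|{: 'I_m * bool}|)%N by rewrite card_prod card_ord card_bool muln_gt0 m0.
(* The factor 32 = 4 * 2 ^ 3 counts the sets of at most three of the 2m thresholds. *)
have bound (G : {set 'I_n}) : G \subset J ->
    (forall T : {set 'I_m * bool}, #|T| = 4%N -> ~~ shatters (upset Q t @: G) T) ->
    (#|G| <= 32 * m ^ 3)%N.
  move=> GJ nsh; have := card_no_shattered X0 nsh.
  rewrite card_in_imset; last first.
    move=> j j' /(subsetP GJ) jJ /(subsetP GJ) jJ'; exact: (upset_inj Q1 QtJ t01 Qinj jJ jJ').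
  by rewrite card_prod card_ord card_bool expnMn mulnCA mulnC.
have [[s sE]|nohalf] := pselect (exists s, level t s = 2^-1); last first.
  apply: leq_trans (bound J (subxx _) _) _; last by rewrite leq_mul2r orbT.
  move=> T cT; apply/negP => shT; apply: nohalf.
  exact: (shattered4_level Q1 QtJ cT shT).
rewrite -(cardsID [set j | s \in upset Q t j] J).
have sub (A : {set 'I_n}) : congruent_to Q t (J :&: A).
  by move=> j; rewrite inE => /andP[/QtJ].
have nrm := entry_le1 s.1 _ Q1.
suff [h1 h2] : (#|J :&: [set j | s \in upset Q t j]| <= 32 * m ^ 3 /\
    #|J :\: [set j | s \in upset Q t j]| <= 32 * m ^ 3)%N.
  by apply: leq_trans (leq_add h1 h2) _; rewrite -mulnDl.
have vals j : j \in J -> if s \in upset Q t j then Q s.1 j = 2^-1 else Q s.1 j = - 2^-1.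
  move=> jJ; have := upset_gap s QtJ jJ.
  have /intrP[z Qz] := QtJ j jJ s.1; have := nrm j.
  have -> : Q s.1 j = level t s + (z - s.2%:R : int)%:~R.
    by rewrite rmorphB /= -Qz /level; case: s.2 => /=; ring.
  rewrite ler_norml sE; move: (z - _ : int) => y {Qz z} /andP[h1 h2]; case: ifP => _ h3.
    have : -1 < y < 1 by apply/andP; split; rewrite -(ltr_int R); lra.
    by move=> yr; rewrite (_ : y = 0) ?addr0 //; lia.
  have : -2 < y < 0 by apply/andP; split; rewrite -(ltr_int R); lra.
  by move=> yr; rewrite (_ : y = -1); [field|lia].
split; apply: bound; rewrite ?subsetIl ?subsetDl // => T cT.
  apply: (const_row_no_shattered4 (i0 := s.1) (eta := 2^-1)) => //.
    by move=> j; rewrite !inE => /andP[/vals]; rewrite inE => + h; rewrite h.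
  by rewrite ger0_norm ?invr_ge0.
rewrite setDE; apply: (const_row_no_shattered4 (i0 := s.1) (eta := - 2^-1)) => //.
  by move=> j; rewrite !inE => /andP[/vals]; rewrite inE => + h; rewrite (negPf h).
by rewrite normrN ger0_norm ?invr_ge0.
Qed.

(** * Residue classes modulo a full-rank integer matrix *)

Lemma absz_det_unimodular (m : nat) (L : 'M[int]_m) : L \in unitmx -> `|\det L|%N = 1%N.
Proof.
move=> uL; have := congr1 (fun M => `|\det M|%N) (mulmxV uL).
by rewrite det_mulmx det1 abszM => /eqP; rewrite muln_eq1 => /andP[/eqP].
Qed.

(** In Smith normal form the quotient by the lattice of the columns of [B] is a
    product of cyclic groups whose orders are the diagonal entries. *)
Lemma residue_classes (m : nat) (B : 'M[int]_m) :
  \det B != 0 ->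
  exists (K : finType) (key : 'cV[int]_m -> K), #|K| = `|\det B|%N /\
    forall x y, key x = key y -> exists w, x - y = B *m w.
Proof.
move=> B0; have [L uL [R uR [ds _ BE]]] := int_Smith_normal_form B.
pose d (i : 'I_m) := ds`_i.
set D := \matrix_(i, j) _ in BE.
have DE : D = diag_mx (\row_i d i).
  by apply/matrixP => i j; rewrite !mxE -val_eqE.
have detB : `|\det B|%N = (\prod_(i < m) `|d i|)%N.
  rewrite BE !det_mulmx !abszM (absz_det_unimodular uL) (absz_det_unimodular uR) mul1n muln1 DE det_diag.
  by rewrite (big_morph absz abszM (erefl _)); apply: eq_bigr => i _; rewrite mxE.
have d0 (i : 'I_m) : d i != 0.
  apply: contraNneq B0 => di0; rewrite -absz_eq0 detB (bigD1 i) //= di0 absz0 mul0n //.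
pose F (i : 'I_m) : finType := 'I_(`|d i|.-1.+1).
pose key (x : 'cV[int]_m) : {dffun forall i, F i} :=
  [ffun i => inord `|((invmx L *m x) i ord0 %% d i)%Z|%N : F i].
exists {dffun forall i, F i}, key; split.
  rewrite card_dep_ffun foldrE big_image detB; apply: eq_bigr => i _.
  by rewrite card_ord prednK // absz_gt0.
move=> x y /ffunP kxy.
have kdvd (i : 'I_m) : (d i %| (invmx L *m (x - y)) i ord0)%Z.
  have := congr1 val (kxy i); rewrite !ffunE /=.
  have lt z : (`|(z %% d i)%Z| < `|d i|.-1.+1)%N.
    rewrite prednK ?absz_gt0 // -ltz_nat gez0_abs ?modz_ge0 //.
    by rewrite abszE ltz_mod.
  rewrite !inordK // => /(congr1 Posz); rewrite !gez0_abs ?modz_ge0 // => /eqP.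
  by rewrite eqz_mod_dvd mulmxBr !mxE.
exists (invmx R *m \col_i ((invmx L *m (x - y)) i ord0 %/ d i)%Z).
rewrite BE -!mulmxA mulKVmx // -[LHS](mulKVmx uL); congr (_ *m _).
apply/colP => i; rewrite DE mul_diag_mx !mxE mulrC divzK //.
by have := kdvd i; rewrite mxE.
Qed.

(** * Maximal minors *)

Lemma increasing_reindex (m n : nat) (g : 'I_m -> 'I_n) :
  injective g ->
  exists (f : {ffun 'I_m -> 'I_n}) (s : 'S_m), increasing_ffun f /\ g =1 f \o s.
Proof.
move=> g_inj; pose S := [set g i | i in 'I_m].
have cS : m = #|S| by rewrite card_imset // card_ord.
pose f : {ffun 'I_m -> 'I_n} := [ffun i => Order.enum_val (cast_ord cS i)].
have f_inj : injective f.
  by move=> i j; rewrite !ffunE => /Order.EnumVal.enum_val_inj /cast_ord_inj.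
have [h hK] : exists h : 'I_m -> 'I_m, forall i, f (h i) = g i.
  have gS i : g i \in S by apply: imset_f.
  exists (fun i => cast_ord (esym cS) (Order.enum_rank_in (gS i) (g i))) => i.
  by rewrite ffunE cast_ordKV Order.EnumVal.enum_rankK_in.
have h_inj : injective h by move=> i j hij; apply: g_inj; rewrite -!hK hij.
exists f, (perm h_inj); split => [|i]; last by rewrite /= permE hK.
apply/'forall_forallP => i j; apply/implyP => ij.
rewrite !ffunE ltnNge; apply/negP => le.
have := @Order.EnumVal.le_enum_val _ 'I_n (@le_total _ _) (mem S) (cast_ord cS j) (cast_ord cS i).
by rewrite !leEord /= le leqNgt ij.
Qed.

Lemma det_le_max_minor (R : realDomainType) (m n : nat) (A : 'M[R]_(m, n)) (g : 'I_m -> 'I_n) :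
  `|\det (colsub g A)| <= max_minor A.
Proof.
have max0 : 0 <= max_minor A by apply: bigmax_ge_id.
case: (boolP (injectiveb g)) => [/injectiveP g_inj|/injectivePn[i [j ij gij]]].
  have [f [s [incf gE]]] := increasing_reindex g_inj.
  have -> : colsub g A = col_perm s (colsub f A).
    by apply/matrixP => i j; rewrite !mxE gE.
  rewrite col_permE det_mulmx det_perm normrM normrX normrN1 expr1n mulr1.
  exact: (le_bigmax_cond 0 (fun f : {ffun 'I_m -> 'I_n} => `|\det (colsub f A)|)).
rewrite -det_tr (determinant_alternate ij) ?normr0 // => k.
by rewrite !mxE gij.
Qed.

Lemma max_minor_attained (R : realDomainType) (m n : nat) (A : 'M[R]_(m, n)) :
  0 < max_minor A -> exists f : {ffun 'I_m -> 'I_n}, `|\det (colsub f A)| = max_minor A.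
Proof.
move=> A0; apply: contrapT => noneg; suff : max_minor A < max_minor A by rewrite ltxx.
rewrite {1}/max_minor bigmax_lt // => f _; rewrite lt_neqAle det_le_max_minor andbT.
by apply/eqP => fA; apply: noneg; exists f.
Qed.

Lemma map_intr_inj (m n : nat) : injective (map_mx (intr : int -> rat) : 'M_(m, n) -> _).
Proof.
by move=> x y /matrixP xy; apply/matrixP => i j; have := xy i j; rewrite !mxE => /intr_inj.
Qed.

Lemma heller_upper_bound (Delta m n : nat) :
  (0 < Delta)%N -> (0 < m)%N -> heller_admissible Delta m n -> (n <= 64 * m ^ 3 * Delta)%N.
Proof.
move=> Delta0 m0 [_ [A [_ Ainj modA]]].
have [|f fA] := @max_minor_attained _ _ _ A; first by rewrite modA.
rewrite modA in fA; pose B := colsub f A.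
have detB0 : \det B != 0 by rewrite -normr_eq0 fA; case: (Delta) Delta0.
have [K [key [cK keyP]]] := residue_classes detB0.
have {}cK : #|K| = Delta by apply/eqP; rewrite cK -eqz_nat abszE fA.
pose toQ p q (M : 'M[int]_(p, q)) : 'M[rat]_(p, q) := map_mx intr M.
have uB : toQ _ _ B \in unitmx by rewrite unitmxE det_map_mx unitfE intr_eq0.
pose Q := invmx (toQ _ _ B) *m toQ _ _ A.
have fQ : colsub f Q = 1%:M by rewrite -mulmx_colsub -map_mxsub mulVmx.
have Q1 : minors_le1 Q.
  move=> k r g r_inj; apply: (minor_le1 g fQ _ r_inj) => g'.
  rewrite -mulmx_colsub -map_mxsub det_mulmx det_inv !det_map_mx normrM normfV.
  rewrite -!intr_norm fA mulrC ler_pdivrMr ?ltr0z ?mul1r // ler_int.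
  by rewrite -modA det_le_max_minor.
have colQ j : col j Q = invmx (toQ _ _ B) *m toQ _ _ (col j A).
  by rewrite /toQ map_col !colE -mulmxA.
have Qinj : injective (fun j => col j Q).
  move=> j j'; rewrite /= !colQ => /(can_inj (mulKVmx uB)).
  by move=> /map_intr_inj /Ainj.
pose class c := [set j | key (col j A) == c].
have card_cls c : (#|class c| <= 64 * m ^ 3)%N.
  have [->|[j0 j0c]] := set_0Vmem (class c); first by rewrite cards0.
  pose t i := Q i j0 - (Num.floor (Q i j0))%:~R.
  apply: (@card_class _ _ _ Q t) => //.
    move=> j; rewrite inE => /eqP jc i; move: j0c; rewrite inE => /eqP j0c.
    have [w wE] := keyP _ _ (etrans jc (esym j0c)).
    have -> : Q i j - t i = (Q i j - Q i j0) + (Num.floor (Q i j0))%:~R.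
      by rewrite /t; ring.
    rewrite rpredD ?intr_int //.
    have /colP/(_ i) : col j Q - col j0 Q = toQ _ _ w.
      rewrite !colQ -mulmxBr -map_mxB wE map_mxM; exact: mulKmx.
    by rewrite !mxE => ->; rewrite intr_int.
  move=> i; have := floor_itv (Q i j0); rewrite /t rmorphD /= => /andP[h1 h2].
  by apply/andP; split; lra.
rewrite -[X in (X <= _)%N]card_ord -sum1_card (partition_big (fun j => key (col j A)) xpredT) //=.
apply: (@leq_trans (\sum_(c : K) 64 * m ^ 3)%N).
  apply: leq_sum => c _; rewrite sum1_card; apply: leq_trans (card_cls c).
  by apply: subset_leq_card; apply/subsetP => j; rewrite !inE.
by rewrite sum_nat_const cK mulnC.
Qed.

Lemma heller_admissible_square (Delta m : nat) :
  (0 < Delta)%N -> (0 < m)%N -> heller_admissible Delta m m.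
Proof.
move=> Delta0; case: m => // m _; split=> //.
pose d : 'rV[int]_m.+1 := \row_i (if i == ord0 then Delta%:Z else 1).
have detd : \det (diag_mx d) = Delta%:Z.
  rewrite det_diag (bigD1 ord0) //= mxE eqxx big1 ?mulr1 // => i /negPf i0.
  by rewrite mxE i0.
have d0 : \det (diag_mx d) != 0 by rewrite detd; case: (Delta) Delta0.
exists (diag_mx d); split.
- apply/eqP; rewrite /int_rank -[_ == _]/(row_free _) row_free_unit unitmxE det_map_mx.
  by rewrite unitfE intr_eq0.
- move=> j j' /colP/(_ j); rewrite !mxE eqxx mulr1n; case: (j =P j') => // _.
  by rewrite mulr0n; case: ifP => _ // [D0]; rewrite D0 in Delta0.
apply/eqP; rewrite /modular eq_le; apply/andP; split.
  apply: bigmax_le => // f incf.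
  have f_inj : injective f.
    have inc (i j : 'I_m.+1) : (i < j)%N -> (f i < f j)%N.
      by move: incf => /forallP/(_ i)/forallP/(_ j)/implyP.
    move=> i j fij; apply: val_inj; apply/eqP; case: ltngtP => // /inc.
      by rewrite fij ltnn.
    by rewrite fij ltnn.
  rewrite (_ : colsub f _ = col_perm (perm f_inj) (diag_mx d)); last first.
    by apply/matrixP => i j; rewrite !mxE permE.
  by rewrite col_permE det_mulmx detd det_perm normrM normrX normrN1 expr1n mulr1.
rewrite -[X in X <= _](_ : `|\det (colsub id (diag_mx d))| = _) ?det_le_max_minor //.
rewrite (_ : colsub id _ = diag_mx d) ?detd //.
by apply/matrixP => i j; rewrite !mxE.
Qed.

Theorem corollary1 (R : realType) :
  exists C : R,
    0 < C /\
    forall Delta m : nat, (1 <= Delta)%N -> (1 <= m)%N ->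
      is_generalized_heller Delta m (generalized_heller Delta m) /\
      (generalized_heller Delta m)%:R <= C * m%:R ^+ 3 * Delta%:R.
Proof.
exists 64; split => // Delta m Delta0 m0.
have [h hP] : exists h, is_generalized_heller Delta m h.
  have exn : exists n, `[< heller_admissible Delta m n >].
    by exists m; apply/asboolP/heller_admissible_square.
  have bnd n : `[< heller_admissible Delta m n >] -> (n <= 64 * m ^ 3 * Delta)%N.
    by move=> /asboolP; apply: heller_upper_bound.
  case: (ex_maxnP exn bnd) => h /asboolP hadm hmax.
  by exists h; split => // n nadm; apply: hmax; apply/asboolP.
have hell : is_generalized_heller Delta m (generalized_heller Delta m).
  by apply: (@xgetPex _ 0%N (fun h => is_generalized_heller Delta m h)); exists h.
split => //; rewrite -natrX -!natrM ler_nat; apply: heller_upper_bound => //.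
by case: hell.
Qed.
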